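(* Let $q_n\in(0,1]$, $n=1,2,\dots$, with $q_n\to0$ as $n\to\infty$, and for each $n$ consider $q_n$-proportion Bulgarian solitaire. The limit shape $\phi$ of stable configurations (under the standard scaling in which the diagram has height $1$ and area $1$) depends on the asymptotic behavior of $nq_n^2$ as follows. (a) If $nq_n^2\to0$, the limit shape exists and is triangular: with height $1$ and downward slope $1/2$, i.e. $\phi(x)=\max(1-x/2,\,0)$. (b) If $nq_n^2\to\infty$, the limit shape exists and is exponential: $\phi(x)=e^{-x}$. (c) If $nq_n^2\to C$ with $0<C<\infty$, define $z>0$ by the equation $$2C=\frac{z^2+\lceil z\rceil^2}{\lceil z\rceil}-\sum_{i=0}^{\lceil z\rceil-1}\frac{1}{\lceil z\rceil-i},$$ put $Z=\lceil z\rceil$, $A_0=\frac{z}{C}\cdot\frac{1+z-Z}{Z}$, and $A_k=\frac{z}{C}\cdot\frac{1}{Z-k}$ for $1\le k\le Z-1$. Then the limit shape exists and is the continuous piecewise linear function $\phi$ that starts at height $1$ at $x=0$, consists of $Z$ consecutive linear sections numbered $0,1,\dots,Z-1$ from left to right, where section $i$ has width $A_i$ and downward slope $\frac{C(Z-i)}{z^2}$ (so that height $0$ is reached at $x=A_0+\dots+A_{Z-1}$), and is $0$ thereafter.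
   Context: A configuration of $n$ cards is an integer partition $\lambda=(\lambda_1\ge\lambda_2\ge\cdots\ge\lambda_\ell>0)$ of $n$, extended by $\lambda_i=0$ for $i>\ell$. In a move of $q$-proportion Bulgarian solitaire ($q\in(0,1]$), $\lceil qh\rceil$ cards are picked from each nonempty pile of size $h$, all picked cards together form one new pile, and the resulting piles are sorted in weakly decreasing order (empty piles being discarded). A configuration is stable if a move leaves it unchanged; for each number of cards there is at most one stable configuration, and there is always one with a single card. For a partition $\lambda$ of $m$, the downscaled diagram-boundary function is $\partial\lambda(x)=\frac{1}{\lambda_1}\lambda_{\lfloor xm/\lambda_1\rfloor+1}$ for $x\ge0$. For each $n$, let $n^*(n)$ be the largest $n'\le n$ for which a stable configuration of $q_n$-proportion Bulgarian solitaire with $n'$ cards exists, and let $\lambda^{(n^*(n))}$ be that stable configuration. A function $\phi$ is the limit shape of stable configurations if $\partial\lambda^{(n^*(n))}(x)\to\phi(x)$ as $n\to\infty$ for all $x>0$. *)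

(* Defs.v *)
From mathcomp Require Import all_boot all_order all_algebra.
From mathcomp Require Import all_classical all_reals all_analysis.

Set Implicit Arguments.
Unset Strict Implicit.
Unset Printing Implicit Defensive.

Import Order.TTheory GRing.Theory Num.Theory.
Import numFieldNormedType.Exports.

Local Open Scope classical_set_scope.
Local Open Scope ring_scope.

(* The parts of the partition are listed in weakly decreasing order, so the
   part of (1-based) index i is [nth 0%N s i.-1], which is 0 beyond the last
   part. *)
Definition is_partition (n : nat) (s : seq nat) : bool :=
  [&& sorted geq s, 0%N \notin s & sumn s == n].

Definition picked (R : realType) (q : R) (h : nat) : nat :=
  `|Num.ceil (q * h%:R)|%N.

(* For 0 < q <= 1 one has picked q h <= h, so the subtraction of natural
   numbers below is exact. *)
Definition solitaire_move (R : realType) (q : R) (s : seq nat) : seq nat :=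
  sort geq [seq h <- sumn (map (picked q) s) :: [seq h - picked q h | h <- s]%N
           | (0 < h)%N].

Definition is_stable (R : realType) (q : R) (n : nat) (s : seq nat) : Prop :=
  is_partition n s /\ solitaire_move q s = s.

(* The value m = 0, reached by the empty partition, is never the maximum when
   0 < n and 0 < q <= 1, since [:: 1] is stable. *)
Definition nstar (R : realType) (q : R) (n : nat) : nat :=
  (\max_(m < n.+1 | `[< exists s, is_stable q m s >]) m)%N.

(* The stable configuration of n cards. There is at most one when
   0 < q <= 1; the value is [::] if there is none. *)
Definition stable_conf (R : realType) (q : R) (n : nat) : seq nat :=
  xget [::] [set s | is_stable q n s].

(* Since [nth] is 0-based, the index floor(x m / lambda_1) + 1 becomes
   floor(x m / lambda_1). *)
Definition boundary (R : realType) (s : seq nat) (x : R) : R :=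
  (nth 0%N s (Num.truncn (x * (sumn s)%:R / (head 0%N s)%:R)))%:R
    / (head 0%N s)%:R.

Definition is_limit_shape (R : realType) (q : nat -> R) (phi : R -> R) : Prop :=
  forall x : R, 0 < x ->
    (fun n : nat => boundary (stable_conf (q n) (nstar (q n) n)) x) @ \oo
      --> phi x.

(* Section i < k has width w i and downward slope d i. The last two clauses
   together force the height to be 0 at the right end of the last section. *)
Definition is_piecewise_linear (R : realType) (k : nat) (w d : nat -> R)
    (phi : R -> R) : Prop :=
  let left_end i := \sum_(j < i) w j in
  [/\ {within `[0, +oo[, continuous phi},
      phi 0 = 1,
      forall i : nat, (i < k)%N -> forall x : R,
        left_end i <= x <= left_end i.+1 ->
        phi x = phi (left_end i) - d i * (x - left_end i)
    & forall x : R, left_end k <= x -> phi x = 0].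

Definition ceil_nat (R : realType) (z : R) : nat := `|Num.ceil z|%N.

Definition z_equation (R : realType) (C z : R) : Prop :=
  let Z := ceil_nat z in
  2 * C = (z ^+ 2 + Z%:R ^+ 2) / Z%:R - \sum_(i < Z) (Z%:R - i%:R)^-1.

Definition section_width (R : realType) (C z : R) (k : nat) : R :=
  let Z := ceil_nat z in
  if k == 0%N then z / C * ((1 + z - Z%:R) / Z%:R)
  else z / C * (Z%:R - k%:R)^-1.

Definition section_slope (R : realType) (C z : R) (i : nat) : R :=
  C * ((ceil_nat z)%:R - i%:R) / z ^+ 2.

(* Main.v *)
Require Import Defs.
From mathcomp Require Import all_boot all_order all_algebra.
From mathcomp Require Import all_classical all_reals all_analysis.
From mathcomp Require Import zify ring lra.

Import Order.TTheory GRing.Theory Num.Theory.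
Import numFieldNormedType.Exports.

Local Open Scope classical_set_scope.
Local Open Scope ring_scope.

(* A stable configuration is an orbit h, f h, f (f h), ... of the map
   f k = k - ceil (q k), and every h gives one; passing from h to h + 1
   enlarges it by at most h + 1 cards. Hence nstar is within h + 1 of n, and
   only the orbit has to be analysed. With w = q h there are three regimes.
   (a) If w <= 1 the orbit is h, h - 1, ..., 1.
   (b) If w tends to infinity, the orbit is within 1/q of h (1 - q)^k.
   (c) In the remaining regime the rescaled orbit q h_k follows the flow
   y' = - ceil y. With time y the integral of 1 / ceil u over [0, y] and area y
   that of u / ceil u, the quantity time (q h_k) + q k is conserved until the
   orbit reaches 0, and q^2 times the number of cards equals area w, both up to
   O(q). So area w tends to C, and area z = C is the equation defining z; the
   limit shape satisfies time (z phi x) = max (time z - x C / z) 0. *)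

(** * Stable configurations as orbits *)

Section Orbit.
Set Implicit Arguments.
Unset Strict Implicit.
Context {R : realType}.
Implicit Types (q x y z : R) (h k n : nat) (s : seq nat).

Lemma ceil_nat_itv x : 0 <= x -> (ceil_nat x)%:R - 1 < x <= (ceil_nat x)%:R.
Proof.
move=> x0; have c0 : 0 <= Num.ceil x by rewrite ceil_ge0; lra.
have -> : (ceil_nat x)%:R = (Num.ceil x)%:~R :> R.
  by rewrite /ceil_nat natr_absz ger0_norm.
by have := ceil_itv x; rewrite rmorphB.
Qed.

Lemma ceil_nat_leE x n : 0 <= x -> (ceil_nat x <= n)%N = (x <= n%:R).
Proof.
move=> /ceil_nat_itv/andP[xl xu]; apply/idP/idP => [|xn].
  by rewrite -(ler_nat R); apply: le_trans.
by rewrite -ltnS -(ltr_nat R) -natr1; lra.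
Qed.

Lemma ceil_nat_gt0 x : 0 < x -> (0 < ceil_nat x)%N.
Proof. by move=> x0; rewrite ltnNge (ceil_nat_leE 0 (ltW x0)) -ltNge. Qed.

Lemma picked_itv q h : 0 <= q ->
  (picked q h)%:R - 1 < q * h%:R <= (picked q h)%:R.
Proof. by move=> q0; apply: ceil_nat_itv; rewrite mulr_ge0. Qed.

Lemma picked_leq q h : 0 < q <= 1 -> (picked q h <= h)%N.
Proof.
move=> /andP[q0 q1]; rewrite (@ceil_nat_leE (q * h%:R)).
  by rewrite ler_piMl.
by rewrite mulr_ge0// ltW.
Qed.

Lemma picked_gt0 q h : 0 < q -> (0 < h)%N -> (0 < picked q h)%N.
Proof. by move=> q0 h0; apply: ceil_nat_gt0; rewrite mulr_gt0 ?ltr0n. Qed.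

Lemma leq_picked q h h' : 0 < q -> (h <= h')%N ->
  (picked q h <= picked q h')%N.
Proof.
move=> q0 hh'; rewrite (@ceil_nat_leE (q * h%:R)) ?mulr_ge0 ?(ltW q0)//.
have /andP[_ qp] := picked_itv h' (ltW q0); apply: (le_trans _ qp).
by rewrite ler_pM2l ?ler_nat.
Qed.

Definition step q h := (h - picked q h)%N.

(* h + 1 iterates suffice, since [step] decreases every positive number. *)
Definition orbit q h := [seq k <- traject (step q) h h.+1 | (0 < k)%N].

Lemma step0 q : step q 0 = 0%N. Proof. by []. Qed.

Lemma step_ltn q h : 0 < q -> (0 < h)%N -> (step q h < h)%N.
Proof. by move=> q0 h0; rewrite ltn_subrL picked_gt0. Qed.

Lemma step_leq q h : (step q h <= h)%N.
Proof. exact: leq_subr. Qed.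

(** Since [q <= 1], the products [q * h] and [q * (h + 1)] differ by at most [1], so their ceilings
    differ by [0] or [1]. *)
Lemma step_leqS q h : 0 < q <= 1 -> (step q h <= step q h.+1 <= (step q h).+1)%N.
Proof.
move=> q01; have /andP[q0 q1] := q01.
have /andP[a b] := @picked_itv q h (ltW q0).
have /andP[c d] := @picked_itv q h.+1 (ltW q0).
have := picked_leq h q01; have := leq_picked q0 (leqnSn h).
have : (picked q h.+1 <= (picked q h).+1)%N.
  by rewrite -ltnS -(ltr_nat R) -!natr1; move: c; rewrite -natr1 mulrDr mulr1; lra.
by rewrite /step; lia.
Qed.

Lemma leq_step q h h' : 0 < q <= 1 -> (h <= h')%N -> (step q h <= step q h')%N.
Proof.
move=> q01 /subnKC <-; elim: (h' - h)%N => [|d ih]; first by rewrite addn0.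
by rewrite addnS (leq_trans ih)//; have /andP[] := step_leqS (h + d) q01.
Qed.

Lemma iter_step_leqS q h k : 0 < q <= 1 ->
  (iter k (step q) h <= iter k (step q) h.+1 <= (iter k (step q) h).+1)%N.
Proof.
move=> q01; elim: k => [|k /andP[a b]]; first by rewrite /= leqnSn leqnn.
rewrite !iterS leq_step//=; apply: leq_trans (leq_step q01 b) _.
by have /andP[] := step_leqS (iter k (step q) h) q01.
Qed.

Lemma iter_step_leq q h k : 0 < q -> (iter k (step q) h <= h - k)%N.
Proof.
move=> q0; elim: k => [|k ih]; first by rewrite subn0.
rewrite iterS; have [->|x0] := posnP (iter k (step q) h); first by rewrite step0.
by have := step_ltn q0 x0; lia.
Qed.

Lemma iter_step0 q h k : 0 < q -> (h <= k)%N -> iter k (step q) h = 0%N.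
Proof. by move=> q0 hk; have := iter_step_leq h k q0; lia. Qed.

Let geq_trans : transitive geq.
Proof. by move=> a b c ba ac; apply: leq_trans ac ba. Qed.

(** Zeros of a weakly decreasing list are at its end, where the default value [0] of [nth] stands in
    for them. *)
Lemma nth_filter_gt0 s k : sorted geq s ->
  nth 0%N [seq j <- s | (0 < j)%N] k = nth 0%N s k.
Proof.
elim: s k => [//|a s ih] k ps /=.
have [a0|_] := posnP a; last by case: k => [//|k] /=; apply/ih/(path_sorted ps).
rewrite {a}a0 in ps *; have s0 : all (geq 0%N) s.
  exact: (@order_path_min _ geq 0%N s geq_trans ps).
have -> : [seq j <- s | (0 < j)%N] = [::].
  by apply/eqP; rewrite -(negbK (_ == _)) -has_filter -all_predC;
    apply: sub_all s0 => j /=; rewrite lt0n negbK leqn0.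
rewrite nth_nil; case: k => [//|k] /=.
by have [ks|/(nth_default _)->//] := ltnP k (size s);
  have /(all_nthP 0%N)/(_ _ ks) := s0; rewrite /= leqn0 => /eqP->.
Qed.

Lemma sorted_traject_step q h n : sorted geq (traject (step q) h n).
Proof.
case: n => [//|n] /=; apply: sub_path (fpath_traject _ _ _) => a b /= /eqP <-.
exact: step_leq.
Qed.

Lemma sorted_orbit q h : sorted geq (orbit q h).
Proof. exact/(sorted_filter geq_trans)/sorted_traject_step. Qed.

Lemma nth_orbit q h k : 0 < q -> nth 0%N (orbit q h) k = iter k (step q) h.
Proof.
move=> q0; rewrite nth_filter_gt0 ?sorted_traject_step//.
have [kh|hk] := ltnP k h.+1; last first.
  by rewrite nth_default ?size_traject// iter_step0// ltnW.
by rewrite (set_nth_default h) ?size_traject// nth_traject.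
Qed.

Lemma eq_from_nth0 s t : 0%N \notin s -> 0%N \notin t ->
  (forall k, nth 0%N s k = nth 0%N t k) -> s = t.
Proof.
move=> s0 t0 st; apply: (@eq_from_nth _ 0%N) => [|//].
have le_size u v : 0%N \notin u -> (forall k, nth 0%N u k = nth 0%N v k) ->
    (size u <= size v)%N.
  move=> u0 uv; rewrite leqNgt; apply/negP => vu; move/negP: u0; apply.
  by rewrite -(nth_default 0%N (leqnn (size v))) -uv mem_nth.
by apply/eqP; rewrite eqn_leq !le_size.
Qed.

Lemma notin0_filter_gt0 s : 0%N \notin [seq j <- s | (0 < j)%N].
Proof. by rewrite mem_filter. Qed.

Lemma sumn_filter_gt0 s : sumn [seq j <- s | (0 < j)%N] = sumn s.
Proof. by elim: s => [//|[|a] s ih] /=; rewrite ih. Qed.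

Lemma sumn_orbitE q h : 0 < q ->
  sumn (orbit q h) = (\sum_(k < h) iter k (step q) h)%N.
Proof.
move=> q0; rewrite sumn_filter_gt0 trajectSr sumn_rcons.
rewrite iter_step0// addn0 sumnE (big_nth h) size_traject big_mkord.
by apply: eq_bigr => i _; rewrite nth_traject.
Qed.

(** Allowing any summation bound [n >= h] puts the orbits of [h] and [h.+1] over one index range. *)
Lemma sumn_orbitW q h n : 0 < q -> (h <= n)%N ->
  sumn (orbit q h) = (\sum_(k < n) iter k (step q) h)%N.
Proof.
move=> q0 hn; rewrite sumn_orbitE// -!(big_mkord predT (fun k =>
  iter k (step q) h)).
rewrite (big_cat_nat (leq0n h) hn)/= [X in _ = (_ + X)%N]big_nat [X in _ = (_ +
  X)%N]big1 ?addn0//.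
by move=> k /andP[hk _]; rewrite iter_step0.
Qed.

Lemma sumn_map_picked q s : 0 < q <= 1 ->
  (sumn (map (picked q) s) + sumn (map (step q) s) = sumn s)%N.
Proof.
move=> q01; elim: s => [//|a s ih] /=; rewrite -ih /step.
by have := picked_leq a q01; lia.
Qed.

Lemma nth_map_step q s k : nth 0%N (map (step q) s) k = step q (nth 0%N s k).
Proof.
have [ks|sk] := ltnP k (size s); first by rewrite (nth_map 0%N).
by rewrite !nth_default ?size_map.
Qed.

Lemma sorted_map_step q s : 0 < q <= 1 -> sorted geq s ->
  sorted geq (map (step q) s).
Proof. by move=> q01; apply: homo_sorted => a b /= /(leq_step q01). Qed.

Lemma orbitE q h : 0 < q <= 1 -> (0 < h)%N ->
  orbit q h = h :: [seq j <- map (step q) (orbit q h) | (0 < j)%N].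
Proof.
move=> q01 h0; have /andP[q0 _] := q01.
apply: eq_from_nth0 => [||[|k]].
- exact: notin0_filter_gt0.
- by rewrite inE negb_or notin0_filter_gt0 andbT neq_ltn h0.
- by rewrite nth_orbit.
- rewrite /= nth_filter_gt0 ?sorted_map_step ?sorted_orbit//.
  by rewrite nth_map_step !nth_orbit.
Qed.

(** By [orbitE], one step turns the orbit, up to zeros, into itself without its first pile, so
    exactly [h] cards have been picked. *)
Lemma sumn_picked_orbit q h : 0 < q <= 1 -> sumn (map (picked q) (orbit q h)) = h.
Proof.
move=> q01; have [->//|h0] := posnP h.
have := sumn_map_picked (orbit q h) q01; rewrite [in RHS]orbitE//= sumn_filter_gt0.
by move/addIn.
Qed.

Lemma orbit_stable q h : 0 < q <= 1 -> is_stable q (sumn (orbit q h)) (orbit q h).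
Proof.
move=> q01; split.
  by rewrite /is_partition sorted_orbit notin0_filter_gt0 eqxx.
have [->//|h0] := posnP h.
rewrite /solitaire_move sumn_picked_orbit//=  h0 -orbitE//.
exact/(sorted_sort geq_trans)/sorted_orbit.
Qed.

(** The new pile must be the largest one: all others were reduced strictly below [h], yet [h] is
    present after the move. The remaining piles are then the images under [step], so each pile is
    the image of the preceding one. *)
Lemma stable_orbit q n s : 0 < q <= 1 -> is_stable q n s ->
  s = orbit q (head 0%N s).
Proof.
move=> q01; have /andP[q0 _] := q01; case: s => [|h s] [/and3P[ss s0 _]];
  first by [].
rewrite /solitaire_move; set N := sumn _;
  pose u := [seq j <- map (step q) (h :: s) | (0 < j)%N].
have h0 : (0 < h)%N by move: s0; rewrite inE negb_or eq_sym lt0n => /andP[].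
have N0 : (0 < N)%N by rewrite /N /= ltn_addr// picked_gt0.
move=> st.
have {}st : sort geq (N :: u) = h :: s.
  by rewrite -st; congr sort; rewrite /= N0.
have su : sorted geq u.
  by apply: (sorted_filter geq_trans); exact: (@sorted_map_step q (h :: s)).
have uh j : j \in u -> (j < h)%N.
  rewrite mem_filter => /andP[j0 /mapP[i ih def_j]].
  have : (i <= h)%N.
    move: ih; rewrite inE => /orP[/eqP->//|].
    by move/allP: (order_path_min geq_trans ss); apply.
  have [i0|i0] := posnP i; last by move=> ?; rewrite def_j;
    apply: leq_trans (step_ltn q0 i0) _.
  by move: j0; rewrite def_j /= i0.
have Nh : N = h.
  have : h \in N :: u by rewrite -(mem_sort geq) st mem_head.
  by rewrite inE => /orP[/eqP->//|/uh]; rewrite ltnn.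
have sNu : sorted geq (N :: u).
  by rewrite /= path_min_sorted//; apply/allP => j /uh jh; rewrite Nh /=;
    apply: ltnW.
move: st; rewrite (sorted_sort geq_trans)// Nh => -[us].
apply: eq_from_nth0 => // [|k]; first exact: notin0_filter_gt0.
rewrite nth_orbit//=; elim: k => [//|k ih].
rewrite iterS -ih -nth_map_step -[nth _ (h :: s) _]/(nth 0%N s k) -[in LHS]us.
by rewrite nth_filter_gt0//; exact: (@sorted_map_step q (h :: s)).
Qed.

Lemma sumn_orbit_ltnS q h : 0 < q <= 1 ->
  (sumn (orbit q h) < sumn (orbit q h.+1))%N.
Proof.
move=> q01; have /andP[q0 _] := q01.
rewrite (sumn_orbitW q0 (leqnSn h)) sumn_orbitE// !big_ord_recl /= -addSn.
by apply: leq_add => //; apply: leq_sum => i _;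
  have /andP[] := iter_step_leqS h (lift ord0 i) q01.
Qed.

Lemma sumn_orbit_leqS q h : 0 < q <= 1 ->
  (sumn (orbit q h.+1) <= sumn (orbit q h) + h.+1)%N.
Proof.
move=> q01; have /andP[q0 _] := q01.
rewrite (sumn_orbitW q0 (leqnSn h)) sumn_orbitE//.
rewrite -[X in (_ <= _ + X)%N](card_ord h.+1) -sum1_card -big_split /=.
by apply: leq_sum => i _; rewrite addn1; have /andP[] := iter_step_leqS h i q01.
Qed.

(** The orbit of [h.+1] is stable with more cards than the maximal configuration, so it has more
    than [n]; it exceeds the orbit of [h] by at most [h + 1] cards. *)
Lemma stable_conf_orbit q n : 0 < q <= 1 ->
  exists2 h, stable_conf q (nstar q n) = orbit q h &
    (sumn (orbit q h) <= n < sumn (orbit q h) + h.+1)%N.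
Proof.
move=> q01.
have [m mA nE] : exists2 m : 'I_n.+1, (exists s, is_stable q m s) & nstar q n = m.
  pose A := [pred m : 'I_n.+1 | `[< exists s, is_stable q m s >]].
  have A0 : (0 < #|A|)%N.
    (* The empty partition, stable with [0] cards, makes the range of the maximum nonempty. *)
    by apply/card_gt0P; exists ord0; apply/asboolP; exists [::].
  have [m /asboolP mA nE] := eq_bigmax_cond (fun m : 'I_n.+1 => m : nat) A0.
  by exists m.
have st : is_stable q m (stable_conf q (nstar q n)).
  by rewrite nE; exact: (@xgetPex _ [::] [set s | is_stable q m s]).
exists (head 0%N (stable_conf q (nstar q n))); first exact: stable_orbit st.
move: (stable_orbit q01 st); set s := stable_conf _ _; set h := head _ _ => sE.
have sm : sumn s = m by case: st => /and3P[_ _ /eqP].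
rewrite -sE sm -ltnS ltn_ord /=.
rewrite -sm sE; apply: leq_trans (sumn_orbit_leqS h q01).
rewrite ltnNge; apply/negP => hn.
have := sumn_orbit_ltnS h q01; rewrite -sE sm ltnNge -nE => /negP; apply.
have hn' : (sumn (orbit q h.+1) < n.+1)%N by [].
apply: (@bigop.bigmax_sup _ (Ordinal hn')) => //.
by apply/asboolP; exists (orbit q h.+1); exact: orbit_stable.
Qed.

End Orbit.

(** * The limiting flow *)

Section Profile.
Set Implicit Arguments.
Unset Strict Implicit.
Context {R : realType}.
Implicit Types (q x y z : R) (i j k n : nat).

Definition harmonic_sum n : R := \sum_(i < n) i.+1%:R^-1.

Lemma harmonic_sumS n : harmonic_sum n.+1 = harmonic_sum n + n.+1%:R^-1.
Proof. exact: big_ord_recr. Qed.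

Lemma harmonic_sum1 : harmonic_sum 1 = 1.
Proof. by rewrite harmonic_sumS /harmonic_sum big_ord0 add0r invr1. Qed.

Lemma harmonic_sum_le n : harmonic_sum n <= n%:R.
Proof.
elim: n => [|n ih]; first by rewrite /harmonic_sum big_ord0.
rewrite harmonic_sumS -natr1 lerD// invf_le1 ?ltr0n//.
by rewrite lerDr.
Qed.

(* The value 1 (rather than 0) at y = 0 keeps division by [ceil1 y] meaningful. *)
Definition ceil1 y := maxn 1 (ceil_nat y).

(* [time y] and [area y] below are the integrals over [0, y] of 1 / ceil u and of
   u / ceil u. They equal the minimum over j > 0 of [time_at j y] and [area_at j y],
   attained at j = ceil1 y, whence the bounds [time_diff] and [area_diff]. *)
Definition time_at j y := y / j%:R + harmonic_sum j - 1.

Definition area_at j y := (y ^+ 2 / j%:R + j%:R - harmonic_sum j) / 2.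

Definition time y := time_at (ceil1 y) y.

Definition area y := area_at (ceil1 y) y.

Lemma ceil1_gt0 y : (0 < ceil1 y)%N.
Proof. by rewrite /ceil1; lia. Qed.

Lemma ceil1_0 : ceil1 0 = 1%N.
Proof. by rewrite /ceil1 /ceil_nat ceil0. Qed.

Lemma ceil1_ceil y : 0 < y -> ceil1 y = ceil_nat y.
Proof. by move=> /ceil_nat_gt0 ?; apply/maxn_idPr. Qed.

Lemma ceil1_ge y : 0 <= y -> y <= (ceil1 y)%:R.
Proof.
by move=> /ceil_nat_itv/andP[_ yc]; apply: le_trans yc _; rewrite ler_nat leq_maxr.
Qed.

Lemma ceil1_gt y j : 0 <= y -> (0 < j)%N -> (j < ceil1 y)%N -> j%:R < y.
Proof.
move=> y0 j0; rewrite /ceil1 leq_max => /orP[|]; first by case: j j0.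
by rewrite ltnNge (ceil_nat_leE _ y0) -ltNge.
Qed.

Lemma ceil1_leq y y' : 0 <= y' -> y' <= y -> (ceil1 y' <= ceil1 y)%N.
Proof.
move=> y'0 yy'; rewrite geq_max ceil1_gt0 (ceil_nat_leE _ y'0).
exact: le_trans yy' (ceil1_ge (le_trans y'0 yy')).
Qed.

Lemma valley_min (u : nat -> R) m j : (0 < m)%N -> (0 < j)%N ->
  (forall i, (m <= i)%N -> u i <= u i.+1) ->
  (forall i, (0 < i < m)%N -> u i.+1 <= u i) -> u m <= u j.
Proof.
move=> m0 j0 up down; have [mj|/ltnW jm] := leqP m j.
  rewrite -(subnKC mj); elim: (j - m)%N => [|d ih]; first by rewrite addn0.
  by rewrite addnS (le_trans ih)// up// leq_addr.
have : forall d, (d < m)%N -> u m <= u (m - d)%N.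
  elim=> [|d ih] dm; first by rewrite subn0.
  apply: le_trans (ih (ltnW dm)) _; have -> : (m - d = (m - d.+1).+1)%N by lia.
  by apply: down; lia.
by move=> /(_ (m - j)%N); rewrite subKn//; apply; lia.
Qed.

(** The increment in [j] changes sign where [j] passes [y], so the minimum over [j] is at the
    ceiling of [y]; the same holds for [area_atS]. *)
Lemma time_atS j y : (0 < j)%N ->
  time_at j.+1 y - time_at j y = (j%:R - y) / (j%:R * j.+1%:R).
Proof.
move=> j0; rewrite /time_at harmonic_sumS -natr1.
have j0' : 0 < j%:R :> R by rewrite ltr0n.
by field; rewrite !gt_eqF ?addr_gt0.
Qed.

Lemma area_atS j y : (0 < j)%N ->
  area_at j.+1 y - area_at j y = (j%:R ^+ 2 - y ^+ 2) / (2 * j%:R * j.+1%:R).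
Proof.
move=> j0; rewrite /area_at harmonic_sumS -natr1.
have j0' : 0 < j%:R :> R by rewrite ltr0n.
by field; rewrite !gt_eqF ?addr_gt0.
Qed.

Lemma time_min j y : 0 <= y -> (0 < j)%N -> time y <= time_at j y.
Proof.
move=> y0 j0; apply: (@valley_min (time_at^~ y)) => //; first exact: ceil1_gt0.
  move=> i yi; have i0 : (0 < i)%N by apply: leq_trans yi; exact: ceil1_gt0.
  rewrite -subr_ge0 time_atS// divr_ge0// subr_ge0.
  by apply: le_trans (ceil1_ge y0) _; rewrite ler_nat.
move=> i /andP[i0 iy];
  rewrite -subr_le0 time_atS// pmulr_lle0 ?invr_gt0 ?mulr_gt0 ?ltr0n//.
by rewrite subr_le0; apply: ltW; exact: ceil1_gt.
Qed.

Lemma area_min j y : 0 <= y -> (0 < j)%N -> area y <= area_at j y.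
Proof.
move=> y0 j0; apply: (@valley_min (area_at^~ y)) => //; first exact: ceil1_gt0.
  move=> i yi; have i0 : (0 < i)%N by apply: leq_trans yi; exact: ceil1_gt0.
  rewrite -subr_ge0 area_atS// divr_ge0// subr_ge0 ler_pXn2r ?nnegrE//.
  by apply: le_trans (ceil1_ge y0) _; rewrite ler_nat.
move=> i /andP[i0 iy];
  rewrite -subr_le0 area_atS// pmulr_lle0 ?invr_gt0 ?mulr_gt0 ?ltr0n//.
by rewrite subr_le0 ler_pXn2r ?nnegrE//; apply: ltW; exact: ceil1_gt.
Qed.

Lemma time_diff y y' : 0 <= y' -> y' <= y ->
  (y - y') / (ceil1 y)%:R <= time y - time y' <= (y - y') / (ceil1 y')%:R.
Proof.
move=> y'0 yy'; have y0 := le_trans y'0 yy'.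
have := time_min y'0 (ceil1_gt0 y); have := time_min y0 (ceil1_gt0 y').
by rewrite /time /time_at !mulrBl => ? ?; apply/andP; split; lra.
Qed.

Lemma area_diff y y' : 0 <= y' -> y' <= y ->
  y' * ((y - y') / (ceil1 y)%:R) <= area y - area y' <= y * ((y - y') / (ceil1
    y')%:R).
Proof.
move=> y'0 yy'; have y0 := le_trans y'0 yy'.
have s0 : 0 < (ceil1 y)%:R^-1 :> R by rewrite invr_gt0 ltr0n ceil1_gt0.
have s'0 : 0 < (ceil1 y')%:R^-1 :> R by rewrite invr_gt0 ltr0n ceil1_gt0.
have := area_min y'0 (ceil1_gt0 y); have := area_min y0 (ceil1_gt0 y').
rewrite /area /area_at; move: s0 s'0.
set u := (ceil1 y)%:R^-1; set v := (ceil1 y')%:R^-1 => u0 v0 ? ?.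
(* A branch [area_at j] grows by [(y + y') / 2 * (y - y') / j]; replacing the mean by [y'] or [y]
   changes this by half of one of these squares. *)
have ? : 0 <= (y - y') ^+ 2 * u by rewrite mulr_ge0 ?sqr_ge0 ?(ltW u0).
have ? : 0 <= (y - y') ^+ 2 * v by rewrite mulr_ge0 ?sqr_ge0 ?(ltW v0).
by apply/andP; split; nra.
Qed.

Lemma time0 : time 0 = 0.
Proof. by rewrite /time ceil1_0 /time_at harmonic_sum1; lra. Qed.

Lemma area0 : area 0 = 0.
Proof. by rewrite /area ceil1_0 /area_at harmonic_sum1; lra. Qed.

Lemma time_lt y y' : 0 <= y' -> y' < y -> time y' < time y.
Proof.
move=> y'0 yy'; have /andP[+ _] := time_diff y'0 (ltW yy').
rewrite -subr_gt0; apply: lt_le_trans.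
by rewrite divr_gt0 ?subr_gt0// ltr0n ceil1_gt0.
Qed.

Lemma area_lt y y' : 0 <= y' -> y' < y -> area y' < area y.
Proof.
have pos a b : 0 < a -> a < b -> area a < area b.
  move=> a0 ab; have /andP[+ _] := area_diff (ltW a0) (ltW ab).
  rewrite -subr_gt0; apply: lt_le_trans.
  by rewrite mulr_gt0// divr_gt0 ?subr_gt0// ltr0n ceil1_gt0.
(* The lower bound of [area_diff] vanishes at [y' = 0]; the midpoint provides a positive left
   end. *)
move=> y'0 yy'; pose m := (y' + y) / 2.
apply: (@le_lt_trans _ _ (area m)); last by apply: pos; rewrite /m; lra.
have y'm : y' <= m by rewrite /m; lra.
have /andP[+ _] := area_diff y'0 y'm.
rewrite -[_ <= area m]subr_ge0; apply: le_trans.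
by rewrite mulr_ge0// divr_ge0 ?subr_ge0.
Qed.

(** Adjacent branches agree at integers, so branch [j] is valid on the closed interval, including
    [y = j - 1], where [ceil1 y] is [j - 1] if [j > 1]. *)
Lemma time_atE j y : (0 < j)%N -> j%:R - 1 <= y <= j%:R -> 0 <= y ->
  time y = time_at j y.
Proof.
move=> j0 /andP[jy yj] y0.
have sj : (ceil1 y <= j)%N by rewrite geq_max j0 (ceil_nat_leE _ y0).
move: sj; rewrite leq_eqVlt => /orP[/eqP sE|lt_sj]; first by rewrite /time sE.
have := ceil1_ge y0; move: lt_sj; case: j j0 jy yj => // j _ jy yj;
  rewrite ltnS => lt_sj ys.
have jE : ceil1 y = j.
  by apply/eqP; rewrite eqn_leq lt_sj -(ler_nat R); apply: le_trans ys; move: jy;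
    rewrite -natr1; lra.
have yE : y = j%:R by apply/le_anti; rewrite -{1}jE ys; move: jy; rewrite -natr1;
  lra.
by apply/eqP; rewrite eq_sym -subr_eq0 {1}/time jE time_atS -?jE ?ceil1_gt0// jE
  yE subrr mul0r.
Qed.

End Profile.

(** * Orbits compared with the flow *)

Section Estimates.
Set Implicit Arguments.
Unset Strict Implicit.
Context {R : realType}.
Implicit Types (q x y z : R) (h k n : nat).

Lemma natr_step q h : 0 < q <= 1 -> (step q h)%:R = h%:R - (picked q h)%:R :> R.
Proof. by move=> q01; rewrite natrB ?picked_leq. Qed.

Lemma sumn_orbit_rec q h : 0 < q <= 1 -> (0 < h)%N ->
  sumn (orbit q h) = (h + sumn (orbit q (step q h)))%N.
Proof.
move=> q01 h0; have /andP[q0 _] := q01.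
rewrite (sumn_orbitE h q0); case: h h0 => // h _; rewrite big_ord_recl; congr addn.
rewrite (sumn_orbitW q0 (n := h)); last by rewrite -ltnS step_ltn.
by apply: eq_bigr => i _; rewrite lift0 iterSr.
Qed.

Lemma orbit_ind q (q0 : 0 < q) (P : nat -> Prop) : P 0%N ->
  (forall h, (0 < h)%N -> P (step q h) -> P h) -> forall h, P h.
Proof.
move=> P0 ih; elim/ltn_ind => h ih'; have [->//|h0] := posnP h.
by apply: ih => //; apply/ih'/step_ltn.
Qed.

(** Picking [p] cards from the pile [h] lowers [h ^ 2] by at most [2 * h * p], while the orbit sum
    loses [h]; and [p] is at most [q * h + 1]. *)
Lemma sqr_le_sumn_orbit q h : 0 < q <= 1 ->
  h%:R ^+ 2 <= 2 * (q * h%:R + 1) * (sumn (orbit q h))%:R :> R.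
Proof.
move=> q01; have /andP[q0 _] := q01.
(* [M] bounds the number picked at every pile of the orbit and stays fixed in the induction. *)
suff: forall M, q * h%:R + 1 <= M -> h%:R ^+ 2 <= 2 * M * (sumn (orbit q h))%:R
  by apply.
move=> M; elim/(orbit_ind q0): h => [|h h0 ih] hM.
  by rewrite expr0n/= mulr0.
have xM : q * (step q h)%:R + 1 <= M.
  by apply: le_trans hM; rewrite lerD2r ler_pM2l// ler_nat step_leq.
have := ih xM; rewrite (sumn_orbit_rec q01 h0) natrD natr_step//.
have /andP[pq _] := picked_itv h (ltW q0); have := ler_nat R (picked q h) h.
rewrite picked_leq// => ph.
have p0 : 0 <= (picked q h)%:R :> R by [].
set x := h%:R in hM pq ph *; set p := (picked q h)%:R in pq ph p0 *.
set T := (sumn _)%:R => hT.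
have : p * (2 * x - p) <= M * (2 * x).
  apply: ler_pM => //; nra.
nra.
Qed.

(** A pile [k] gives up at least [q * k] cards, and over the orbit these picks add up to [h]. *)
Lemma sumn_orbit_le q h : 0 < q <= 1 -> q * (sumn (orbit q h))%:R <= h%:R.
Proof.
move=> q01; have /andP[q0 _] := q01.
elim/(orbit_ind q0): h => [|h h0 ih]; first by rewrite mulr0.
move: ih; rewrite (sumn_orbit_rec q01 h0) natrD natr_step//.
have /andP[_ pq] := picked_itv h (ltW q0).
rewrite mulrDr; lra.
Qed.

(** Rounding up loses less than one further card per step; damped by the factor [1 - q], these
    losses stay below the geometric series of sum [1 / q]. *)
Lemma iter_step_itv q h k : 0 < q <= 1 ->
  h%:R * (1 - q) ^+ k - q^-1 <= (iter k (step q) h)%:R <= h%:R * (1 - q) ^+ k.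
Proof.
move=> q01; have /andP[q0 q1] := q01.
have qV : q * q^-1 = 1 by rewrite divff ?gt_eqF.
have qV0 : 0 < q^-1 by rewrite invr_gt0.
elim: k => [|k /andP[a b]].
  by rewrite expr0 mulr1 /= lexx andbT gerBl ltW.
rewrite iterS natr_step// exprSr mulrA.
have /andP[c d] := picked_itv (iter k (step q) h) (ltW q0).
set x := (iter k (step q) h)%:R in a b c d *; set p := (picked q _)%:R in c d *.
set B := h%:R * _ in a b *.
apply/andP; split; nra.
Qed.

(** Sums the lower bounds for the first [k] piles: after multiplication by [q], each error [1 / q]
    counts [1]. *)
Lemma sumn_orbit_ge q h k : 0 < q <= 1 ->
  h%:R * (1 - (1 - q) ^+ k) - k%:R <= q * (sumn (orbit q h))%:R.
Proof.
move=> q01; have /andP[q0 q1] := q01.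
have qV : q * q^-1 = 1 by rewrite divff ?gt_eqF.
apply: (@le_trans _ _ (q * (\sum_(i < k) iter i (step q) h)%:R)); last first.
  rewrite ler_pM2l// ler_nat (sumn_orbitW q0 (leq_maxl h k)).
  rewrite -!(big_mkord predT (fun i => iter i (step q) h)).
  by rewrite (big_cat_nat (leq0n k) (leq_maxr h k)) leq_addr.
elim: k => [|k ih]; first by rewrite big_ord0 expr0 subrr !mulr0 subr0.
rewrite big_ord_recr/= natrD mulrDr exprS.
have /andP[a _] := iter_step_itv h k q01.
set x := (iter k (step q) h)%:R in a *; set u := (1 - q) ^+ k in a ih *.
set T := (_)%:R in ih *.
have : q * (h%:R * u - q^-1) <= q * x by rewrite ler_pM2l.
rewrite mulrBr qV -natr1; lra.
Qed.

Lemma powerB_le q k : 0 < q <= 1 -> (1 - q) ^+ k * (1 + k%:R * q) <= 1.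
Proof.
move=> /andP[q0 q1]; elim: k => [|k ih]; first by rewrite expr0 !mul1r mul0r addr0.
apply: le_trans ih; rewrite exprSr -natr1 -mulrA.
by rewrite ler_wpM2l ?exprn_ge0 ?subr_ge0//; have : 0 <= k%:R :> R := ler0n _ _;
  nra.
Qed.

Lemma sumn_orbit_exponential q h : 0 < q <= 1 -> (0 < h)%N -> 
  1 - 2 / Num.sqrt (q * h%:R) <= q * (sumn (orbit q h))%:R / h%:R <= 1.
Proof.
move=> q01 h0; have /andP[q0 q1] := q01.
have h0' : 0 < h%:R :> R by rewrite ltr0n.
apply/andP; split; last by rewrite ler_pdivrMr// mul1r sumn_orbit_le.
have wE : Num.sqrt (q * h%:R) ^+ 2 = q * h%:R by rewrite sqr_sqrtr// mulr_ge0// ltW.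
have w0 : 0 < Num.sqrt (q * h%:R) by rewrite sqrtr_gt0 mulr_gt0.
set w := Num.sqrt _ in wE w0 *.
(* The cutoff [k] is about [w / q], with [w ^ 2 = q * h]: then [k / h] and [(1 - q) ^ k] are both at
   most [1 / w]. *)
have wq0 : 0 <= w / q by rewrite divr_ge0 ?ltW.
have /andP[k1 k2] := truncn_itv wq0; set k := Num.truncn _ in k1 k2.
rewrite ler_pdivlMr//; apply: le_trans (sumn_orbit_ge h k q01).
rewrite ler_pdivlMr// in k1; rewrite ltr_pdivrMr// -natr1 in k2.
have kw : k%:R <= h%:R / w by rewrite ler_pdivlMr// -(ler_pM2l q0) -wE mulrA [q *
  _]mulrC expr2 ler_pM2r.
have : (1 - q) ^+ k <= w^-1.
  rewrite -[leRHS]mul1r ler_pdivlMr//; apply: le_trans (powerB_le k q01).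
  rewrite ler_wpM2l ?exprn_ge0 ?subr_ge0//. nra.
move=> /(ler_wpM2l (ltW h0')); lra.
Qed.

(** Both bounds come from [1 + u <= exp u], at [u = - q] and, after inversion, at
    [u = q / (1 - q)]. *)
Lemma powerB_exp q k : 0 < q < 1 ->
  expR (- (q * k%:R) / (1 - q)) <= (1 - q) ^+ k <= expR (- (q * k%:R)).
Proof.
move=> /andP[q0 q1]; have q1' : 0 < 1 - q by rewrite subr_gt0.
have -> : - (q * k%:R) = - q * k%:R by rewrite mulNr.
rewrite mulrAC !expRM_natr; apply/andP; split.
  rewrite lerXn2r ?nnegrE ?expR_ge0 ?(ltW q1')//.
  rewrite mulNr expRN invf_ple ?posrE ?expR_gt0//.
  by apply: le_trans (expR_ge1Dx _); rewrite le_eqVlt; apply/orP; left;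
    apply/eqP; field; rewrite gt_eqF.
by rewrite lerXn2r ?nnegrE ?expR_ge0 ?(ltW q1')// expR_ge1Dx.
Qed.

Lemma iter_step_triangular q h k : 0 < q <= 1 -> q * h%:R <= 1 ->
  iter k (step q) h = (h - k)%N.
Proof.
move=> q01 h1; have /andP[q0 _] := q01.
elim: k => [|k ih]; first by rewrite subn0.
rewrite iterS ih; have [hk0|hk0] := posnP (h - k)%N; first by rewrite hk0 step0;
  lia.
have := picked_gt0 q0 hk0.
have : (picked q (h - k) <= 1)%N.
  rewrite (@ceil_nat_leE _ (q * _)) ?mulr_ge0 ?(ltW q0)//.
  by apply: le_trans h1; rewrite ler_pM2l// ler_nat leq_subr.
by rewrite /step; lia.
Qed.

Lemma sumn_orbit_triangular q h : 0 < q <= 1 -> q * h%:R <= 1 ->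
  (2 * sumn (orbit q h) = h * h.+1)%N.
Proof.
move=> q01 h1; have /andP[q0 _] := q01.
elim/(orbit_ind q0): h h1 => [//|h h0 ih] h1.
rewrite (sumn_orbit_rec q01 h0) mulnDr.
have hE : step q h = h.-1 by have := iter_step_triangular 1 q01 h1;
  rewrite /= subn1.
rewrite {}hE in ih *.
rewrite ih; first by case: h h0 {ih h1} => // h _; rewrite /=; nia.
by apply: le_trans h1; rewrite ler_pM2l// ler_nat leq_pred.
Qed.

(** In the variable [y = q * h], a step is an Euler step of length [q] for [y' = - ceil y]. *)
Lemma scaled_step q h : 0 < q <= 1 -> (0 < h)%N ->
  q * h%:R - q * (step q h)%:R = q * (ceil1 (q * h%:R))%:R.
Proof.
move=> q01 h0; have /andP[q0 _] := q01.
rewrite -mulrBr natr_step// ceil1_ceil ?mulr_gt0 ?ltr0n//.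
by rewrite opprB addrC subrK.
Qed.

(* Freezing ceil on one step from y to y' costs at most a multiple of
   q (ceil y - ceil y'), and these errors telescope along the orbit. *)
Lemma area_orbit q h : 0 < q <= 1 ->
  area (q * h%:R) <= q ^+ 2 * (sumn (orbit q h))%:R + q * (q * h%:R) * (ceil1 (q
    * h%:R))%:R
  /\ q ^+ 2 * (sumn (orbit q h))%:R <= area (q * h%:R) + q * (q * h%:R).
Proof.
move=> q01; have /andP[q0 _] := q01; split.
(* The factor [q * h] varies along the orbit; with the fixed bound [W] in its place the errors
   [s - s'] telescope. *)
- suff: forall W, q * h%:R <= W ->
    area (q * h%:R) <= q ^+ 2 * (sumn (orbit q h))%:R + q * W * (ceil1 (q *
      h%:R))%:R by apply.
  move=> W; elim/(orbit_ind q0): h => [|h h0 ih] hW.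
    by rewrite !mulr0 area0 add0r ceil1_0 mulr1 mulr_ge0 ?(ltW q0)// -(mulr0 q).
  have y'0 : 0 <= q * (step q h)%:R by rewrite mulr_ge0 ?(ltW q0).
  have yy' : q * (step q h)%:R <= q * h%:R by rewrite ler_pM2l// ler_nat step_leq.
  have /andP[_] := area_diff y'0 yy'; have := ih (le_trans yy' hW).
  have ss := ceil1_leq y'0 yy'; rewrite -(ler_nat R) in ss.
  have s1 : 1 <= (ceil1 (q * (step q h)%:R))%:R :> R by rewrite ler1n ceil1_gt0.
  rewrite (sumn_orbit_rec q01 h0) natrD mulrDr.
  rewrite scaled_step//.
  move: s1 ss; set s := (ceil1 (q * h%:R))%:R; set s' := (ceil1 _)%:R => s1 ss.
  (* As [1 <= s' <= s], the ratio [s / s' = 1 + (s - s') / s'] is at most [1 + (s - s')]. *)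
  have : q * s / s' <= q + q * (s - s').
    rewrite ler_pdivrMr; last lra.
    have : 0 <= q * ((s - s') * (s' - 1)) by rewrite !mulr_ge0 ?subr_ge0// ltW.
    lra.
  move=> ?.
  have : q * h%:R * (q * s / s') <= q * h%:R * (q + q * (s - s')).
    by rewrite ler_wpM2l// mulr_ge0 ?(ltW q0).
  have : q * h%:R * (q * (s - s')) <= W * (q * (s - s')).
    by rewrite ler_wpM2r// mulr_ge0 ?subr_ge0 ?(ltW q0).
  nra.
- elim/(orbit_ind q0): h => [|h h0 ih].
    by rewrite !mulr0 area0 addr0.
  have y'0 : 0 <= q * (step q h)%:R by rewrite mulr_ge0 ?(ltW q0).
  have yy' : q * (step q h)%:R <= q * h%:R by rewrite ler_pM2l// ler_nat step_leq.
  have /andP[+ _] := area_diff y'0 yy'.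
  rewrite scaled_step//.
  rewrite mulfK ?pnatr_eq0 -?lt0n ?ceil1_gt0//.
  move: ih; rewrite (sumn_orbit_rec q01 h0) natrD mulrDr; lra.
Qed.

(** A step from a positive pile lowers [time] by at least [q], and by at most [q] times the ratio of
    the old to the new ceiling; the excess of the latter over [q] telescopes. The maximum with [0]
    covers an orbit resting at [0]. *)
Lemma time_orbit q h k : 0 < q <= 1 ->
  time (q * h%:R) - q * k%:R - q * (ceil1 (q * h%:R))%:R
    <= time (q * (iter k (step q) h)%:R)
    <= Num.max 0 (time (q * h%:R) - q * k%:R).
Proof.
move=> q01; have /andP[q0 _] := q01.
have time_ge0 j : 0 <= time (q * j%:R).
  rewrite -time0; have [->|j0] := posnP j; first by rewrite mulr0.
  by rewrite ltW// time_lt// mulr_gt0 ?ltr0n.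
pose y j := q * (iter j (step q) h)%:R; pose s j : R := (ceil1 (y j))%:R.
have y0 j : 0 <= y j by rewrite mulr_ge0 ?(ltW q0).
have s1 j : 1 <= s j by rewrite ler1n ceil1_gt0.
have lo_hi j : time (y j) - q - q * (s j - s j.+1) <= time (y j.+1)
    <= Num.max 0 (time (y j) - q).
  have [x0|x0] := posnP (iter j (step q) h).
    have yj : y j = 0 by rewrite /y x0 mulr0.
    have yjS : y j.+1 = 0 by rewrite /y iterS x0 step0 mulr0.
    rewrite /s yj yjS time0 subrr mulr0 le_max lexx andbT; lra.
  have yy' : y j.+1 <= y j by rewrite ler_pM2l// ler_nat step_leq.
  have /andP[] := time_diff (y0 j.+1) yy'.
  have -> : y j - y j.+1 = q * s j.
    exact: scaled_step.
  rewrite -/(s j) -/(s j.+1) mulfK ?gt_eqF ?(lt_le_trans ltr01)// => ? ?.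
  have ss : s j.+1 <= s j by rewrite ler_nat ceil1_leq.
  have : q * s j / s j.+1 <= q + q * (s j - s j.+1).
    rewrite ler_pdivrMr ?(lt_le_trans ltr01)//.
    have : 0 <= q * ((s j - s j.+1) * (s j.+1 - 1)) by rewrite !mulr_ge0
      ?subr_ge0// ltW.
    lra.
  by move=> ?; rewrite le_max; apply/andP; split; last (apply/orP; right); lra.
have [lo hi] : time (y 0%N) - q * k%:R - q * (s 0%N - s k) <= time (y k) /\
    time (y k) <= Num.max 0 (time (y 0%N) - q * k%:R).
  elim: k => [|k [lo hi]]; first by rewrite subrr !mulr0 !subr0 le_max lexx orbT.
  have /andP[lo' hi'] := lo_hi k; split; first by rewrite -natr1; lra.
  apply: le_trans hi' _; rewrite ge_max le_max lexx/=.
  move: hi; rewrite !le_max -natr1 => /orP[|] ?; apply/orP; [left|right]; lra.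
apply/andP; split=> //; apply: le_trans lo.
by rewrite lerD2l lerN2 ler_pM2l// gerBl (le_trans ler01).
Qed.
End Estimates.

(** * Limits *)

Section Continuity.
Set Implicit Arguments.
Unset Strict Implicit.
Context {R : realType}.
Implicit Types (x y z : R) (j k n : nat).

Lemma cvg_of_dist_le (T : Type) (F : set_system T) (FF : Filter F)
    (f g : T -> R) (l : R) :
  (\forall t \near F, `|l - f t| <= g t) -> g @ F --> 0 -> f @ F --> l.
Proof.
move=> fg g0; apply/cvgrPdist_lt => e e0.
apply: (filterS2 _ _ fg (cvgr_lt _ g0 _ e0)) => t; exact: le_lt_trans.
Qed.

Lemma cvg_dist0 (T : Type) (F : set_system T) (FF : Filter F) (u : T -> R) (a : R) :
  u @ F --> a -> `|a - u t| @[t --> F] --> 0.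
Proof.
move=> /cvgrPdist_lt ua; apply/cvgrPdist_lt => e /ua; apply: filterS => t.
by rewrite sub0r normrN normr_id.
Qed.

Lemma cvg_comp_lipschitz (T : Type) (F : set_system T) (FF : Filter F)
    (f : R -> R) (K : R) (u : T -> R) (a : R) :
  (\forall t \near F, `|f a - f (u t)| <= K * `|a - u t|) -> u @ F --> a ->
  f (u t) @[t --> F] --> f a.
Proof.
move=> fK ua; apply: cvg_of_dist_le fK _.
by rewrite -(mulr0 K); apply: cvgMr; exact: cvg_dist0.
Qed.

Lemma max0_dist (a b : R) : `|Num.max 0 a - Num.max 0 b| <= 1 * `|a - b|.
Proof.
rewrite mul1r; have [?|?] := leP 0 a; have [?|?] := leP 0 b => //.
- by rewrite subr0 !ger0_norm; lra.
- by rewrite sub0r normrN distrC !ger0_norm; lra.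
- by rewrite subrr normr0.
Qed.

(** Eventually [f (u t)] lies between [f (z - e)] and [f (z + e)], and monotonicity transfers this
    to [u t]. It serves to invert [area] and [time] in limits. *)
Lemma cvg_of_increasing (f : R -> R) (T : Type) (F : set_system T)
    (FF : Filter F) (u : T -> R) z :
  (forall a b, 0 <= a -> a < b -> f a < f b) -> 0 <= z ->
  (\forall t \near F, 0 <= u t) -> f (u t) @[t --> F] --> f z -> u @ F --> z.
Proof.
move=> f_lt z0 u0 fu; have f_lt_inv a b : 0 <= b -> f a < f b -> a < b.
  move=> b0 fab; rewrite ltNge le_eqVlt; apply/negP => /orP[/eqP ba|ba].
    by rewrite ba ltxx in fab.
  by have := lt_trans fab (f_lt _ _ b0 ba); rewrite ltxx.
apply/cvgrPdist_lt => e e0.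
have lo : \forall t \near F, z - e < u t.
  (* Monotonicity of [f] is given on nonnegative arguments only; for [e > z] the sign of [u] is the
     lower bound. *)
  have [ze|ze] := ltP (z - e) 0.
    by apply: filterS u0 => t; exact: lt_le_trans.
  have fze : f (z - e) < f z by apply: f_lt => //; lra.
  apply: (filterS2 _ _ u0 (cvgr_gt _ fu _ fze)) => t; exact: f_lt_inv.
have fze : f z < f (z + e) by apply: f_lt => //; lra.
apply: (filterS2 _ _ lo (cvgr_lt _ fu _ fze)) => t lot hit.
rewrite ltr_distlC lot/=; apply: f_lt_inv hit; lra.
Qed.

Lemma increasing_lipschitz_surj (f : R -> R) (K B v : R) : 0 <= K -> 0 <= B ->
  (forall a b, 0 <= a -> a <= b -> b <= B -> 0 <= f b - f a <= K * (b - a)) ->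
  f 0 <= v <= f B -> exists2 c, 0 <= c <= B & f c = v.
Proof.
(* Composing [f] with the projection onto [[0, B]] gives a function that is Lipschitz on the whole
   line, to which the intermediate value theorem applies. *)
move=> K0 B0 fK v0B; pose clamp x := Num.min B (Num.max 0 x).
have clamp_itv x : 0 <= clamp x <= B.
  by rewrite /clamp le_min B0 le_max lexx ge_min lexx.
have fg x y : x <= y -> `|f (clamp x) - f (clamp y)| <= K * `|x - y|.
  move=> xy; have /andP[x0 _] := clamp_itv x; have /andP[_ yB] := clamp_itv y.
  have xy' : clamp x <= clamp y by rewrite le_min2// le_max2.
  have /andP[a b] := fK _ _ x0 xy' yB.
  rewrite distrC ger0_norm// (le_trans b)// ler_wpM2l// distrC ger0_norm
    ?subr_ge0//.
  have x_ge0 : 0 <= Num.max 0 x by rewrite le_max lexx.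
  have x_ge : x <= Num.max 0 x by rewrite le_max lexx orbT.
  have max_xy : Num.max 0 y <= Num.max 0 x + (y - x) by rewrite ge_max;
    apply/andP; split; lra.
  have minB : Num.min B (Num.max 0 y) <= B by rewrite ge_min lexx.
  have miny : Num.min B (Num.max 0 y) <= Num.max 0 y by rewrite ge_min lexx orbT.
  rewrite /clamp; case: (leP B (Num.max 0 x)) => ?; lra.
have [c /[!in_itv]/= c0B fc] : exists2 c, c \in `[0, B] & f (clamp c) = v.
  have clampE x : 0 <= x -> x <= B -> clamp x = x.
    by move=> x0 xB; rewrite /clamp (max_idPr x0); apply/min_idPr.
  apply: IVT => //.
    apply: continuous_subspaceT => x;
      apply: (@cvg_comp_lipschitz _ _ _ (f \o clamp) K id); last exact: cvg_id.
    apply: nearW => y /=; have [xy|/ltW yx] := leP x y; first exact: fg.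
    by rewrite distrC [`|x - y|]distrC; exact: fg.
  have /andP[v0 vB] := v0B.
  by rewrite !clampE// ge_min v0 le_max vB orbT.
by exists (clamp c).
Qed.

Lemma ceil1_ge1 y : 1 <= (ceil1 y)%:R :> R.
Proof. by rewrite ler1n ceil1_gt0. Qed.

Lemma ceil1_leD1 y : 0 <= y -> (ceil1 y)%:R <= y + 1.
Proof.
move=> y0; have /andP[cy _] := ceil_nat_itv y0.
by rewrite /ceil1; case: (leqP 1 (ceil_nat y)) => _; lra.
Qed.

Lemma div_ceil1_le x y : 0 <= x -> x / (ceil1 y)%:R <= x.
Proof. by move=> x0; rewrite ler_piMr// invf_le1 ?ceil1_ge1// ltr0n ceil1_gt0. Qed.

Lemma time_lipschitz y y' : 0 <= y' -> y' <= y ->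
  0 <= time y - time y' <= 1 * (y - y').
Proof.
move=> y'0 yy'; have /andP[a b] := time_diff y'0 yy'.
rewrite (le_trans _ a) ?divr_ge0 ?subr_ge0//= mul1r (le_trans b)//.
by rewrite div_ceil1_le// subr_ge0.
Qed.

Lemma time_dist y y' : 0 <= y -> 0 <= y' -> `|time y - time y'| <= 1 * `|y - y'|.
Proof.
move=> y0 y'0; wlog yy' : y y' y0 y'0 / y' <= y => [H|].
  by have [yy'|/ltW y'y] := leP y' y;
    [exact: H | rewrite distrC [`|y - y'|]distrC; exact: H].
by have /andP[a b] := time_lipschitz y'0 yy'; rewrite !ger0_norm// subr_ge0.
Qed.

Lemma area_lipschitz (B y y' : R) : 0 <= y' -> y' <= y -> y <= B ->
  0 <= area y - area y' <= B * (y - y').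
Proof.
move=> y'0 yy' yB; have /andP[a b] := area_diff y'0 yy'.
rewrite (le_trans _ a) ?mulr_ge0 ?divr_ge0 ?subr_ge0//= (le_trans b)//.
have d0 : 0 <= y - y' by rewrite subr_ge0.
by apply: ler_pM; [exact: le_trans yy'|exact: divr_ge0|by []|exact: div_ceil1_le].
Qed.

Lemma time_inj y y' : 0 <= y -> 0 <= y' -> time y = time y' -> y = y'.
Proof.
move=> y0 y'0 yy'; apply/eqP; rewrite -(negbK (_ == _)) neq_lt; apply/negP.
by case/orP => [/(time_lt y0)|/(time_lt y'0)]; rewrite yy' ltxx.
Qed.

Lemma area_inj y y' : 0 <= y -> 0 <= y' -> area y = area y' -> y = y'.
Proof.
move=> y0 y'0 yy'; apply/eqP; rewrite -(negbK (_ == _)) neq_lt; apply/negP.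
by case/orP => [/(area_lt y0)|/(area_lt y'0)]; rewrite yy' ltxx.
Qed.

Lemma time_surj z v : 0 <= z -> 0 <= v <= time z -> exists2 y, 0 <= y & time y = v.
Proof.
move=> z0 vz; have [| |y /andP[y0 _] yv] :=
  @increasing_lipschitz_surj time 1 z v ler01 z0.
- by move=> a b a0 ab _; exact: time_lipschitz.
- by rewrite time0.
by exists y.
Qed.

(** The continuous counterpart of [sqr_le_sumn_orbit], from [harmonic_sum j <= j]; it makes [area]
    unbounded. *)
Lemma area_ge y : 0 <= y -> y ^+ 2 <= 2 * (y + 1) * area y.
Proof.
move=> y0; have s0 : 0 < (ceil1 y)%:R :> R by rewrite ltr0n ceil1_gt0.
have : y ^+ 2 / (ceil1 y)%:R <= 2 * area y.
  by rewrite /area /area_at; have := harmonic_sum_le (R := R) (ceil1 y); lra.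
rewrite ler_pdivrMr// => /le_trans; apply.
have : 0 <= area y by rewrite -area0; move: y0;
  rewrite le_eqVlt => /orP[/eqP<-//|/(area_lt (lexx 0))/ltW].
by have := ceil1_leD1 y0; nra.
Qed.

Lemma area_surj (C : R) : 0 < C -> exists2 z, 0 < z & area z = C.
Proof.
(* This [B] satisfies [2 * (B + 1) * C = B ^ 2 - 1], so [area_ge] gives [C <= area B]. *)
move=> C0; pose B := 2 * C + 1.
have B0 : 0 <= B by rewrite /B; lra.
have [| |z /andP[z0 _] zC] := @increasing_lipschitz_surj area B B C B0 B0.
- by move=> a b a0 ab bB; exact: area_lipschitz.
- rewrite area0 (ltW C0)/=; have := area_ge B0; rewrite /B; nra.
exists z => //; rewrite lt_neqAle z0 andbT; apply/eqP => z0'.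
by move: zC; rewrite -z0' area0; lra.
Qed.

(** Reversing the sum in the equation gives a harmonic number, and the right-hand side becomes
    [2 * area z]. *)
Lemma z_equation_area C z : 0 < z -> z_equation C z <-> area z = C.
Proof.
move=> z0; rewrite /z_equation -ceil1_ceil// /area /area_at.
have -> : \sum_(i < ceil1 z) ((ceil1 z)%:R - i%:R)^-1 = harmonic_sum (ceil1 z) :> R.
  rewrite /harmonic_sum (reindex_inj rev_ord_inj)/=; apply: eq_bigr => i _.
  by rewrite -natrB ?leq_subr// subKn.
have s0 : (ceil1 z)%:R != 0 :> R by rewrite gt_eqF// ltr0n ceil1_gt0.
have -> : (z ^+ 2 + (ceil1 z)%:R ^+ 2) / (ceil1 z)%:R = z ^+ 2 / (ceil1 z)%:R +
  (ceil1 z)%:R.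
  by field.
by split => ?; lra.
Qed.

Lemma z_equation_unique_sol C : 0 < C -> exists! z, 0 < z /\ z_equation C z.
Proof.
move=> C0; have [z z0 zC] := area_surj C0; exists z; split.
  by split=> //; apply/z_equation_area.
move=> z' [z'0 /(z_equation_area _ z'0) z'C].
by apply: area_inj; rewrite ?ltW// zC.
Qed.

End Continuity.

(** * The piecewise linear profile *)

Section PiecewiseLinear.
Set Implicit Arguments.
Unset Strict Implicit.
Context {R : realType} (C z : R) (C0 : 0 < C) (z0 : 0 < z).
Implicit Types (x y : R) (i j k n : nat).

Let Z := ceil1 z.

Let left_end i := \sum_(j < i) section_width C z j.

Let Z_ceil : ceil_nat z = Z.
Proof. by rewrite -ceil1_ceil. Qed.

Let Z0 : (0 < Z)%N := ceil1_gt0 z.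

Let zC0 : 0 < C / z.
Proof. exact: divr_gt0. Qed.

(** [harmonic_sum m] is [time] at the integer [m], so breakpoint [i.+1] is where the flow started at
    [z] reaches height [Z - i.+1]. Each width is [z / C] times the time needed to reach the next
    integer below. *)
Lemma time_left_end i : (i < Z)%N ->
  time z - left_end i.+1 * (C / z) = harmonic_sum (Z - i.+1).
Proof.
have C1 := lt0r_neq0 C0; have z1 := lt0r_neq0 z0.
elim: i => [|i ih] iZ; rewrite /left_end big_ord_recr/=.
  rewrite big_ord0 add0r /section_width eqxx Z_ceil /time /time_at -/Z.
  have Z1 : Z%:R != 0 :> R by rewrite pnatr_eq0 -lt0n.
  have -> : harmonic_sum Z = harmonic_sum (Z - 1) + Z%:R^-1 :> R.
    by have := @harmonic_sumS R (Z - 1); rewrite subn1 prednK.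
  by field; rewrite Z1 C1 z1.
rewrite mulrDl opprD addrA -/(left_end i.+1) ih 1?ltnW//.
have -> : (Z - i.+1 = (Z - i.+2).+1)%N by lia.
rewrite harmonic_sumS /section_width /= Z_ceil.
have -> : (Z - i.+2).+1%:R = Z%:R - i.+1%:R :> R by rewrite -natrB;
  [congr (_%:R); lia | exact: ltnW].
have Zi : Z%:R - i.+1%:R != 0 :> R by rewrite subr_eq0 eqr_nat neq_ltn iZ orbT.
by move: Zi; set u := Z%:R - i.+1%:R => Zi; field; rewrite Zi C1 z1.
Qed.

Lemma left_end_ge0 i : (i <= Z)%N -> 0 <= left_end i.
Proof.
move=> iZ; apply: sumr_ge0 => -[j ji] _ /=; rewrite /section_width Z_ceil.
have zC : 0 <= z / C by rewrite divr_ge0 ?ltW.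
case: eqP => _; rewrite mulr_ge0//.
  have /andP[+ _] := ceil_nat_itv (ltW z0); rewrite Z_ceil => ?.
  by rewrite divr_ge0//; lra.
by rewrite invr_ge0 subr_ge0 ler_nat (leq_trans _ iZ)// ltnW.
Qed.

Lemma left_end_leS i : (i < Z)%N -> left_end i <= left_end i.+1.
Proof.
move=> iZ; rewrite /left_end [leRHS]big_ord_recr /= lerDl /section_width Z_ceil.
have zC : 0 <= z / C by rewrite divr_ge0 ?ltW.
case: eqP => _; rewrite mulr_ge0//.
  have /andP[+ _] := ceil_nat_itv (ltW z0); rewrite Z_ceil => ?.
  by rewrite divr_ge0//; lra.
by rewrite invr_ge0 subr_ge0 ler_nat ltnW.
Qed.

Lemma time_le_harmonic_sum : time z <= harmonic_sum Z.
Proof.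
rewrite /time /time_at -/Z; have : z / Z%:R <= 1.
  by rewrite ler_pdivrMr ?ltr0n// mul1r ceil1_ge// ltW.
lra.
Qed.

(** Between two breakpoints [time y] lies between consecutive harmonic sums, so [y] lies in
    [[Z - i - 1, Z - i]], where [time] is the affine branch [time_at (Z - i)]; the formula inverts
    that branch. *)
Lemma profile_section i x y : (i < Z)%N -> left_end i <= x <= left_end i.+1 ->
  0 <= y -> time y = Num.max 0 (time z - x * (C / z)) ->
  y = (Z%:R - i%:R) * (time z - x * (C / z) - harmonic_sum (Z - i) + 1).
Proof.
move=> iZ /andP[ix xi] y0; set tau := time z - x * (C / z).
have Zi0 : (0 < Z - i)%N by rewrite subn_gt0.
have Zi : Z%:R - i%:R = (Z - i)%:R :> R by rewrite natrB// ltnW.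
have HE : harmonic_sum (Z - i) = harmonic_sum (Z - i.+1) + (Z - i)%:R^-1 :> R.
  have -> : (Z - i = (Z - i.+1).+1)%N by lia.
  by rewrite harmonic_sumS.
have tau_ge : harmonic_sum (Z - i.+1) <= tau.
  by rewrite -time_left_end// lerD2l lerN2 ler_pM2r.
have tau_le : tau <= harmonic_sum (Z - i).
  (* Section [0] starts at [time z], where [z] may lie below the integer [Z]; later sections start
     exactly at a harmonic sum. *)
  move: iZ ix {xi Zi0 Zi HE tau_ge}; case: i => [|i] iZ ix.
    rewrite subn0; apply: le_trans time_le_harmonic_sum.
    rewrite /tau gerBl mulr_ge0//; last exact: ltW.
    by rewrite (le_trans _ ix)// left_end_ge0.
  by rewrite -time_left_end 1?ltnW// lerD2l lerN2 ler_pM2r.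
have h0 n : 0 <= harmonic_sum n :> R by apply: sumr_ge0.
have tau0 : 0 <= tau by apply: le_trans tau_ge.
rewrite (max_idPr tau0) Zi => ytau.
set m := (Z - i)%N in Zi0 HE tau_le *.
have m0 : 0 < m%:R :> R by rewrite ltr0n.
have mV : m%:R * m%:R^-1 = 1 :> R by rewrite divff ?gt_eqF.
have lo : m%:R - 1 <= m%:R * (tau - harmonic_sum m + 1).
  have : m%:R * (harmonic_sum m - m%:R^-1) <= m%:R * tau by rewrite ler_pM2l//; lra.
  by rewrite mulrBr mV; lra.
have hi : m%:R * (tau - harmonic_sum m + 1) <= m%:R.
  by rewrite -[leRHS]mulr1 ler_pM2l//; lra.
have m1 : 1 <= m%:R :> R by rewrite ler1n.
have cand0 : 0 <= m%:R * (tau - harmonic_sum m + 1) by lra.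
apply: time_inj => //; rewrite (time_atE Zi0 _ cand0) ?lo ?hi//.
rewrite ytau /time_at mulrC mulKf ?gt_eqF//; lra.
Qed.

Lemma profile_exists : exists phi : R -> R,
  is_piecewise_linear (ceil_nat z) (section_width C z) (section_slope C z) phi /\
  forall x, 0 <= x ->
    0 <= phi x /\ time (z * phi x) = Num.max 0 (time z - x * (C / z)).
Proof.
have z1 := lt0r_neq0 z0.
(* The constant extension to negative [x] makes [g] continuous on the whole line, with all values in
   the range of [time]. *)
pose g x := Num.max 0 (time z - Num.max 0 x * (C / z)).
have tz0 : 0 <= time z by rewrite -time0 ltW// time_lt.
have /choice[Y HY] : forall x, exists y, 0 <= y /\ time y = g x.
  move=> x; have [|y y0 ty] := @time_surj _ z (g x) (ltW z0); last by exists y.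
  rewrite /g le_max lexx/= ge_max tz0/= gerBl mulr_ge0 ?le_max ?lexx//.
  exact: ltW.
have Y0 x : 0 <= Y x by case: (HY x).
have tY x : time (Y x) = g x by case: (HY x).
have gE x : 0 <= x -> g x = Num.max 0 (time z - x * (C / z)).
  by move=> x0; rewrite /g (max_idPr x0).
have g_cvg x : g t @[t --> x] --> g x.
  apply: (@cvg_comp_lipschitz _ _ _ _ g (C / z) id); last exact: cvg_id.
  apply: nearW => t /=; apply: le_trans (max0_dist _ _) _.
  rewrite mul1r (_ : _ - _ = (Num.max 0 t - Num.max 0 x) * (C / z)); last by ring.
  rewrite normrM distrC mulrC [`|C / z|]ger0_norm ?(ltW zC0)// ler_pM2l//.
  by rewrite -[leRHS]mul1r; exact: max0_dist.
have Y_cvg x : Y t @[t --> x] --> Y x.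
  apply: (@cvg_of_increasing _ time) => //; first by move=> a b; exact: time_lt.
    exact: nearW.
  by under eq_fun do rewrite tY; rewrite tY; exact: g_cvg.
have Ylin i x : (i < Z)%N -> left_end i <= x <= left_end i.+1 ->
    Y x = (Z%:R - i%:R) * (time z - x * (C / z) - harmonic_sum (Z - i) + 1).
  move=> iZ ix; apply: profile_section => //; rewrite tY gE//.
  by move: ix => /andP[+ _]; apply: le_trans; rewrite left_end_ge0// ltnW.
exists (fun x => Y x / z); split; last first.
  by move=> x x0; rewrite [z * _]mulrC divfK// tY gE// divr_ge0// ltW.
rewrite Z_ceil; split.
- by apply: continuous_subspaceT => x; apply: cvgMl; exact: Y_cvg.
- suff -> : Y 0 = z by rewrite divff.
  apply: time_inj; rewrite ?Y0 ?(ltW z0)//.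
  by rewrite tY gE// mul0r subr0; apply/max_idPr.
- move=> i iZ x ix; rewrite !(Ylin i)//; last by rewrite lexx left_end_leS.
  by rewrite /section_slope Z_ceil -/(left_end i); field.
- move=> x Zx; suff -> : Y x = 0 by rewrite mul0r.
  have x0 : 0 <= x by apply: le_trans Zx; apply: left_end_ge0.
  apply: time_inj; rewrite ?Y0// tY time0 gE//; apply/max_idPl.
  have -> : 0 = time z - left_end Z * (C / z).
    have := @time_left_end Z.-1; rewrite prednK// subnn => ->//.
    by rewrite /harmonic_sum big_ord0.
  by rewrite lerD2l lerN2 ler_pM2r.
Qed.

End PiecewiseLinear.

(** * Limit shapes in the three regimes *)

Section LimitShapes.
Set Implicit Arguments.
Unset Strict Implicit.
Context {R : realType} (q : nat -> R).
Context (q_range : forall n : nat, (0 < n)%N -> 0 < q n <= 1).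
Context (q_cvg0 : q @ \oo --> (0 : R)).
Implicit Types (x z : R) (n k : nat).

Let h n := head 0%N (stable_conf (q n) (nstar (q n) n)).
Let N n := sumn (orbit (q n) (h n)).
(** [w] and [T] are the largest pile and the number of cards in the units of the flow; [T] is
    compared with [n * q n ^ 2]. *)
Let w n := q n * (h n)%:R.
Let T n := q n ^+ 2 * (N n)%:R.
Let index x n := Num.truncn (x * (N n)%:R / (h n)%:R).

Let stable_head n : (0 < n)%N ->
  [/\ stable_conf (q n) (nstar (q n) n) = orbit (q n) (h n),
      (0 < h n)%N & (N n <= n < N n + (h n).+1)%N].
Proof.
move=> n0; have q01 := q_range n0; have /andP[q0 _] := q01.
have [m sE bnd] := stable_conf_orbit n q01.
have hm : h n = m by rewrite /h sE -nth0 nth_orbit.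
(* For [m = 0] the bound would read [n < 1]. *)
rewrite /N hm; split=> //; case: m bnd {sE hm} => // /andP[_].
by rewrite ltnNge n0.
Qed.

Let boundaryE n x : (0 < n)%N ->
  boundary (stable_conf (q n) (nstar (q n) n)) x
    = (iter (index x n) (step (q n)) (h n))%:R / (h n)%:R.
Proof.
move=> n0; have /andP[q0 _] := q_range n0; have [sE _ _] := stable_head n0.
by rewrite /boundary -/(h n) sE nth_orbit.
Qed.

Let near_pos : \forall n \near \oo, (0 < n)%N.
Proof. exact: nbhs_infty_gt. Qed.

Let T_le n : (0 < n)%N -> T n <= n%:R * q n ^+ 2.
Proof.
move=> n0; have [_ _ /andP[Nn _]] := stable_head n0.
by rewrite /T mulrC ler_wpM2r ?sqr_ge0// ler_nat.
Qed.

Let T_ge n : (0 < n)%N -> n%:R * q n ^+ 2 <= T n + q n * w n + q n.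
Proof.
move=> n0; have /andP[q0 q1] := q_range n0; have [_ _ /andP[_]] := stable_head n0.
rewrite -(ltr_nat R) natrD -natr1 => /ltW nN.
have : n%:R * q n ^+ 2 <= ((N n)%:R + ((h n)%:R + 1)) * q n ^+ 2.
  by rewrite ler_wpM2r ?sqr_ge0.
rewrite /T /w; nra.
Qed.

Let w_gt0 n : (0 < n)%N -> 0 < w n.
Proof.
move=> n0; have /andP[q0 _] := q_range n0; have [_ h0 _] := stable_head n0.
by rewrite mulr_gt0 ?ltr0n.
Qed.

Let sqr_w_le n : (0 < n)%N -> w n ^+ 2 <= 2 * (w n + 1) * T n.
Proof.
move=> n0; have /andP[q0 _] := q_range n0.
have := sqr_le_sumn_orbit (h n) (q_range n0).
move=> /(ler_wpM2l (sqr_ge0 (q n))); rewrite /w /T -/(N n); lra.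
Qed.

Let T_le_w n : (0 < n)%N -> T n <= w n.
Proof.
move=> n0; have /andP[q0 _] := q_range n0.
by rewrite /T expr2 -mulrA ler_pM2l// sumn_orbit_le// q_range.
Qed.

Let q_indexE n x : (0 < n)%N -> 0 < x ->
  x * (q n * (N n)%:R / (h n)%:R) - q n < q n * (index x n)%:R
    <= x * (q n * (N n)%:R / (h n)%:R).
Proof.
move=> n0 x0; have /andP[q0 _] := q_range n0.
have y0 : 0 <= x * (N n)%:R / (h n)%:R by rewrite divr_ge0// mulr_ge0// ltW.
have -> : x * (q n * (N n)%:R / (h n)%:R) = q n * (x * (N n)%:R / (h n)%:R) by ring.
have /andP[lo hi] := truncn_itv y0; rewrite -/(index x n) -natr1 in lo hi.
rewrite ler_pM2l// lo andbT ltrBlDr -[X in _ + X]mulr1 -mulrDr ltr_pM2l//.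
Qed.

Let q_index_cvg x r : 0 < x -> (q n * (N n)%:R / (h n)%:R) @[n --> \oo] --> r ->
  (q n * (index x n)%:R) @[n --> \oo] --> x * r.
Proof.
move=> x0 qNh; apply: (@squeeze_cvgr _ _ _ _
    (fun n => x * (q n * (N n)%:R / (h n)%:R) - q n)
    (fun n => x * (q n * (N n)%:R / (h n)%:R))).
- near=> n; have n0 : (0 < n)%N by near: n.
  by have /andP[/ltW -> ->] := q_indexE n0 x0.
- by rewrite -[X in _ --> X]subr0; apply: cvgB => //; exact: cvgMr.
- exact: cvgMr.
Unshelve. all: by end_near.
Qed.

Lemma limit_shape_triangular :
  (fun n : nat => n%:R * q n ^+ 2) @ \oo --> (0 : R) ->
  is_limit_shape q (fun x : R => Num.max (1 - x / 2) 0).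
Proof.
move=> nq x x0.
have w_le1 : \forall n \near \oo, w n <= 1.
  (* The value [8^-1] suffices: it gives [w ^ 2 <= (w + 1) / 4], which excludes [w > 1]. *)
  have e0 : (0 : R) < 8^-1 by lra.
  near=> n; have n0 : (0 < n)%N by near: n.
  have Tn : T n <= 8^-1.
    by apply: le_trans (T_le n0) _; near: n; exact: (cvgr_le _ nq _ e0).
  have := sqr_w_le n0; have := w_gt0 n0; nra.
have h_cvg : (h n)%:R^-1 @[n --> \oo] --> (0 : R).
  have h_gt0 : \forall n \near \oo, 0 < (h n)%:R :> R.
    by apply: filterS near_pos => n /stable_head[_ h0 _]; rewrite ltr0n.
  apply/(gtr0_cvgV0 h_gt0).
  apply/cvgryPge => A; near=> n; have n0 : (0 < n)%N by near: n.
  have [_ _ /andP[_ nN]] := stable_head n0.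
  have NE : (2 * N n = h n * (h n).+1)%N.
    by apply: sumn_orbit_triangular; [exact: q_range | near: n].
  rewrite leNgt; apply/negP => hA.
  have hA' : (h n < (Num.truncn A).+1)%N.
    by rewrite -(ltr_nat R); apply: lt_trans hA _; exact: truncnS_gt.
  (* If [h <= m] with [m = truncn A], then [n < (h + 1) * (h + 2) / 2] stays below [(m + 2) ^ 2]. *)
  have : ((Num.truncn A).+2 * (Num.truncn A).+2 <= n)%N by near: n;
    exact: nbhs_infty_ge.
  nia.
(* Before division by [h], the truncation costs at most [1], and the second factor of the card count
   [h * (h + 1) / 2] costs a further [x / 2]. *)
apply: (@cvg_of_dist_le _ _ _ _ _ (fun n => (x / 2 + 1) * (h n)%:R^-1)); last first.
  by rewrite -[X in _ --> X](mulr0 (x / 2 + 1)); exact: cvgMr.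
near=> n; have n0 : (0 < n)%N by near: n.
have [_ h0 _] := stable_head n0; have wn : w n <= 1 by near: n.
have h0' : 0 < (h n)%:R :> R by rewrite ltr0n.
rewrite boundaryE// iter_step_triangular//; last exact: q_range.
have NE : (N n)%:R = (h n)%:R * ((h n)%:R + 1) / 2 :> R.
  have := sumn_orbit_triangular (q_range n0) wn;
    rewrite -/(N n) => /(congr1 (fun k => k%:R : R)).
  by rewrite !natrM -[(h n).+1%:R]natr1; lra.
have iE : x * (N n)%:R / (h n)%:R = x / 2 * ((h n)%:R + 1).
  by rewrite NE; field; rewrite gt_eqF.
have y0 : 0 <= x / 2 * ((h n)%:R + 1) by rewrite mulr_ge0 ?divr_ge0 ?addr_ge0
  ?(ltW x0).
have /andP[lo hi] := truncn_itv y0;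
  rewrite -iE -/(index x n) iE -?[(index x n).+1%:R]natr1 in lo hi.
rewrite -(ler_pM2r h0') mulfVK ?gt_eqF// -[X in _ * X]ger0_norm ?(ltW h0')//
  -normrM.
rewrite mulrBl divfK ?gt_eqF// maxr_pMl ?(ltW h0')// mul0r.
have [hk|kh] := leqP (h n) (index x n).
  have -> : (h n - index x n = 0)%N by apply/eqP; rewrite subn_eq0.
  rewrite subr0; rewrite -(ler_nat R) in hk.
  by case: (leP ((1 - x / 2) * (h n)%:R) 0) => ?; rewrite ?normr0 ?gtr0_norm//; nra.
rewrite natrB ?(ltnW kh)//; rewrite -(ltr_nat R) in kh.
case: (leP ((1 - x / 2) * (h n)%:R) 0) => ?.
  by rewrite sub0r normrN gtr0_norm ?subr_gt0//; nra.
by rewrite ler_norml; apply/andP; split; nra.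
Unshelve. all: by end_near.
Qed.

Lemma limit_shape_exponential :
  (fun n : nat => n%:R * q n ^+ 2) @ \oo --> +oo ->
  is_limit_shape q (fun x : R => expR (- x)).
Proof.
move=> /cvgryPge nq x x0.
have w_cvg : w n @[n --> \oo] --> +oo.
  apply/cvgryPge => A; near=> n; have n0 : (0 < n)%N by near: n.
  have /andP[q0 q1] := q_range n0.
  (* Since [T <= w] and [q <= 1], [T_ge] gives [n * q ^ 2 <= 2 * w + 1]. *)
  have : 2 * A + 1 <= n%:R * q n ^+ 2 by near: n; exact: nq.
  have := T_ge n0; have := T_le_w n0; have := w_gt0 n0; nra.
have wV : (w n)^-1 @[n --> \oo] --> (0 : R).
  by apply/gtr0_cvgV0 => //; apply: filterS near_pos => n; exact: w_gt0.
have qNh : (q n * (N n)%:R / (h n)%:R) @[n --> \oo] --> (1 : R).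
  apply/cvgrPdist_le => e e0; near=> n; have n0 : (0 < n)%N by near: n.
  have [_ h0 _] := stable_head n0.
  have /andP[lo hi] := sumn_orbit_exponential (q_range n0) h0.
  rewrite ger0_norm ?subr_ge0//; apply: (@le_trans _ _ (2 / Num.sqrt (w n))).
    by rewrite /w /N; lra.
  have eV : 0 < 2 / e by rewrite divr_gt0.
  have w2 : (2 / e) ^+ 2 <= w n by near: n; move/cvgryPge: w_cvg; apply.
  have ws : 2 / e <= Num.sqrt (w n) by rewrite -[leLHS]gtr0_norm// -sqrtr_sqr
    ler_sqrt// ltW// w_gt0.
  rewrite ler_pdivrMr ?(lt_le_trans eV)// mulrC -ler_pdivrMr//.
have qi := q_index_cvg x0 qNh; rewrite mulr1 in qi.
pose p n := (1 - q n) ^+ index x n.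
have p_cvg : p @ \oo --> expR (- x).
  apply: (@squeeze_cvgr _ _ _ _
    (fun n => expR (- (q n * (index x n)%:R) / (1 - q n)))
    (fun n => expR (- (q n * (index x n)%:R)))).
  - near=> n; have n0 : (0 < n)%N by near: n.
    have /andP[q0 _] := q_range n0.
    by apply: powerB_exp; rewrite q0/=; near: n; apply: (cvgr_lt _ q_cvg0).
  - apply: continuous_cvg; first exact: continuous_expR.
    rewrite -[X in _ --> X]divr1; apply: cvgM; first exact: cvgN.
    apply: (cvgV (oner_neq0 _)).
    by rewrite -[X in _ --> X]subr0; apply: cvgB => //; exact: cvg_cst.
  - apply: continuous_cvg; first exact: continuous_expR.
    exact: cvgN.
(* The rounding error [1 / q] of [iter_step_itv], divided by [h], is [1 / w]. *)
apply: (@squeeze_cvgr _ _ _ _ (fun n => p n - (w n)^-1) p) => //; last first.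
  by rewrite -[X in _ --> X]subr0; exact: cvgB.
near=> n; have n0 : (0 < n)%N by near: n.
have /andP[q0 _] := q_range n0; have [_ h0 _] := stable_head n0.
have h0' : 0 < (h n)%:R :> R by rewrite ltr0n.
have := iter_step_itv (h n) (index x n) (q_range n0).
rewrite boundaryE// ler_pdivlMr// ler_pdivrMr// [p n * _]mulrC => /andP[lo ->].
rewrite andbT; apply: le_trans lo; rewrite mulrBl [_ * (h n)%:R]mulrC lerD2l lerN2.
by rewrite /w invfM -mulrA mulVf ?mulr1// gt_eqF.
Unshelve. all: by end_near.
Qed.

Lemma limit_shape_piecewise_linear C z (phi : R -> R) : 0 < C -> 0 < z ->
  area z = C -> (fun n : nat => n%:R * q n ^+ 2) @ \oo --> C ->
  (forall x, 0 <= x ->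
    0 <= phi x /\ time (z * phi x) = Num.max 0 (time z - x * (C / z))) ->
  is_limit_shape q phi.
Proof.
move=> C0 z0 zC nq phiE x x0.
(* With [D = C + 1], the bound [w ^ 2 <= 2 * D * (w + 1)] forces [w <= 2 * D + 1]. *)
pose B := 2 * (C + 1) + 1; have C1 : C < C + 1 by lra.
have w_leB : \forall n \near \oo, w n <= B.
  near=> n; have n0 : (0 < n)%N by near: n.
  have nC : n%:R * q n ^+ 2 <= C + 1 by near: n; exact: (cvgr_le _ nq _ C1).
  have := sqr_w_le n0; have := w_gt0 n0; have := le_trans (T_le n0) nC.
  rewrite /B; nra.
have Kq0 K : K * q n @[n --> \oo] --> (0 : R).
  by rewrite -(mulr0 K); exact: cvgMr.
have near_cvg (u v : nat -> R) (a : R) (K : R) : u @ \oo --> a ->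
    (\forall n \near \oo, `|u n - v n| <= K * q n) -> v @ \oo --> a.
  move=> ua uv; rewrite -[v](_ : u \- (u \- v) = v);
    last by apply/funext => n /=; rewrite subKr.
  rewrite -[a]subr0; apply: cvgB => //; apply: cvg_of_dist_le (Kq0 K).
  by apply: filterS uv => n; rewrite sub0r normrN.
have T_cvg : T @ \oo --> C.
  apply: (near_cvg _ _ _ (B + 1) nq); near=> n; have n0 : (0 < n)%N by near: n.
  have /andP[q0 _] := q_range n0; have wB : w n <= B by near: n.
  rewrite ger0_norm ?subr_ge0 ?T_le//; have := T_ge n0; nra.
have area_cvg : area (w n) @[n --> \oo] --> C.
  apply: (near_cvg _ _ _ (B * (B + 1)) T_cvg); near=> n;
    have n0 : (0 < n)%N by near: n.
  have /andP[q0 _] := q_range n0; have wB : w n <= B by near: n.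
  have [lo hi] := area_orbit (h n) (q_range n0).
  rewrite -/(w n) -/(N n) -/(T n) in lo hi.
  have w0 := w_gt0 n0; have sB := ceil1_leD1 (ltW w0).
  have s1 := ceil1_ge1 (w n).
  have : w n * (ceil1 (w n))%:R <= B * (B + 1) by apply: ler_pM => //; lra.
  have : w n <= w n * (ceil1 (w n))%:R by rewrite ler_peMr// ltW.
  by rewrite ler_norml => ? ?; apply/andP; split; nra.
have w_cvg : w @ \oo --> z.
  apply: (@cvg_of_increasing _ area) => //; [by move=> a b;
    exact: area_lt|exact: ltW| |by rewrite zC].
  by apply: filterS near_pos => n /w_gt0/ltW.
have qNh : (q n * (N n)%:R / (h n)%:R) @[n --> \oo] --> C / z.
  have : T n / w n @[n --> \oo] --> C / z.
    by apply: cvgM => //; apply: cvgV => //; rewrite gt_eqF.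
  apply: cvg_trans; apply: near_eq_cvg; near=> n; have n0 : (0 < n)%N by near: n.
  have /andP[q0 _] := q_range n0; have [_ h0 _] := stable_head n0.
  by rewrite /T /w; field; rewrite !gt_eqF// ltr0n.
have qi := q_index_cvg x0 qNh.
pose y n := q n * (iter (index x n) (step (q n)) (h n))%:R.
have y0 n : (0 < n)%N -> 0 <= y n.
  by move=> n0; have /andP[q0 _] := q_range n0; rewrite mulr_ge0// ltW.
have time_w : time (w n) @[n --> \oo] --> time z.
  apply: (@cvg_comp_lipschitz _ _ _ _ time 1 w z _ w_cvg).
  by apply: filterS near_pos => n /w_gt0/ltW w0; apply: time_dist => //; exact: ltW.
have max_cvg : Num.max 0 (time (w n) - q n * (index x n)%:R) @[n --> \oo]
    --> Num.max 0 (time z - x * (C / z)).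
  apply: (@cvg_comp_lipschitz _ _ _ _ (Num.max 0) 1).
    by apply: nearW => n; exact: max0_dist.
  exact: cvgB.
have [phi0 tphi] := phiE x (ltW x0).
(* By [time_orbit], [time (y n)] is within [(B + 1) * q n] of the maximum above, whose limit is
   [time (z * phi x)]; inverting [time] gives the limit of [y]. *)
have y_cvg : y @ \oo --> z * phi x.
  apply: (@cvg_of_increasing _ time) => //; first by move=> a b; exact: time_lt.
  - by rewrite mulr_ge0// ltW.
  - by apply: filterS near_pos => n; exact: y0.
  rewrite tphi; apply: (near_cvg _ _ _ (B + 1) max_cvg).
  near=> n; have n0 : (0 < n)%N by near: n.
  have /andP[q0 _] := q_range n0; have wB : w n <= B by near: n.
  have /andP[lo hi] := time_orbit (h n) (index x n) (q_range n0).
  rewrite -/(w n) -/(y n) in lo hi.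
  have sB := ceil1_leD1 (ltW (w_gt0 n0)).
  rewrite ger0_norm ?subr_ge0// lerBlDl ge_max.
  have ty : 0 <= time (y n).
    rewrite -time0; have := y0 n n0.
    by rewrite le_eqVlt => /orP[/eqP <-//|/(time_lt (lexx 0))/ltW].
  have : (ceil1 (w n))%:R * q n <= (B + 1) * q n by rewrite ler_pM2r//; lra.
  have s0 : 0 <= (ceil1 (w n))%:R * q n by rewrite mulr_ge0// ltW.
  by move=> ?; apply/andP; split; lra.
(* The factor [q n] cancels in [y n / w n], which is the boundary value at [x]. *)
have : y n / w n @[n --> \oo] --> (z * phi x) / z.
  by apply: cvgM => //; apply: cvgV => //; rewrite gt_eqF.
rewrite [z * _]mulrC mulfK ?gt_eqF//.
apply: cvg_trans; apply: near_eq_cvg; near=> n; have n0 : (0 < n)%N by near: n.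
have /andP[q0 _] := q_range n0; have [_ h0 _] := stable_head n0.
by rewrite boundaryE// /y /w; field; rewrite !gt_eqF// ltr0n.
Unshelve. all: by end_near.
Qed.

End LimitShapes.

Theorem theorem5 (R : realType) (q : nat -> R)
    (q_range : forall n : nat, (0 < n)%N -> 0 < q n <= 1)
    (q_cvg0 : q @ \oo --> (0 : R)) :
  [/\ ((fun n : nat => n%:R * q n ^+ 2) @ \oo --> (0 : R) ->
       is_limit_shape q (fun x : R => Num.max (1 - x / 2) 0)),
      ((fun n : nat => n%:R * q n ^+ 2) @ \oo --> +oo ->
       is_limit_shape q (fun x : R => expR (- x)))
    & forall C : R, 0 < C ->
      (fun n : nat => n%:R * q n ^+ 2) @ \oo --> C ->
      (exists! z : R, 0 < z /\ z_equation C z) /\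
      (forall z : R, 0 < z -> z_equation C z ->
       exists phi : R -> R,
         is_piecewise_linear (ceil_nat z)
           (section_width C z) (section_slope C z) phi /\
         is_limit_shape q phi)].
Proof.
split.
- exact: limit_shape_triangular.
- exact: limit_shape_exponential.
- move=> C C0 nq; split; first exact: z_equation_unique_sol.
  move=> z z0 /(z_equation_area _ z0) zC.
  have [phi [phi_lin phiE]] := profile_exists C0 z0.
  by exists phi; split=> //; exact: limit_shape_piecewise_linear zC nq phiE.
Qed.
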